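(* Let $\mathbb{D}$ be a division ring with $|\mathbb{D}|>2$, let $\preceq$ be a preorder on $[n]$, let $\mathcal{R}_{\preceq}\subseteq M_n(\mathbb{D})$ be the associated structural matrix ring, and let $\phi:\mathcal{R}_{\preceq}\to M_n(\mathbb{D})$ be an injective additive Jordan semi-triple map. Then there exist $S\in\mathrm{GL}_n(\mathbb{D})$, signs $\varepsilon_C\in\{1,-1\}\subseteq Z(\mathbb{D})$ and maps $\Theta_C:P_C\mathcal{R}_{\preceq}P_C\to P_CM_n(\mathbb{D})P_C$, indexed by the connected components $C$ of the comparability graph $\Gamma_{\preceq}$, such that $$\phi(X)=S^{-1}\Bigl(\bigoplus_C\varepsilon_C\Theta_C(P_CXP_C)\Bigr)S,\qquad X\in\mathcal{R}_{\preceq}.$$ Moreover, for each connected component $C$, the map $\Theta_C$ is either $\Theta^M_{\sigma_C,g_C}$, with $\sigma_C$ an injective endomorphism of $\mathbb{D}$ and $g_C:\mathop{\preceq_C}\to\operatorname{Cent}(\sigma_C)^\times$ transitive, or $\Theta^A_{\tau_C,h_C}$, with $\tau_C$ an injective anti-endomorphism of $\mathbb{D}$ and $h_C:\mathop{\preceq_C}\to\operatorname{Cent}(\tau_C)^\times$ transitive. Conversely, let $S\in\mathrm{GL}_n(\mathbb{D})$ and, for each connected component $C$ of $\Gamma_{\preceq}$, let $\varepsilon_C\in\{1,-1\}$ and let $\Theta_C$ be either $\Theta^M_{\sigma_C,g_C}$, with $\sigma_C$ an injective endomorphism of $\mathbb{D}$ and $g_C:\mathop{\preceq_C}\to\operatorname{Cent}(\sigma_C)^\times$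 transitive, or $\Theta^A_{\tau_C,h_C}$, with $\tau_C$ an injective anti-endomorphism of $\mathbb{D}$ and $h_C:\mathop{\preceq_C}\to\operatorname{Cent}(\tau_C)^\times$ transitive. Then the map $\mathcal{R}_{\preceq}\to M_n(\mathbb{D})$, $X\mapsto S^{-1}\bigl(\bigoplus_C\varepsilon_C\Theta_C(P_CXP_C)\bigr)S$, is an injective Jordan semi-triple map.
   Context: For a preorder (reflexive and transitive relation) $\preceq$ on $[n]=\{1,\ldots,n\}$, the associated structural matrix ring (SMR) is $\mathcal{R}_{\preceq}:=\{[x_{ij}]\in M_n(\mathbb{D}) : x_{ij}=0 \text{ whenever } i\not\preceq j\}$. A map $\phi:\mathcal{R}\to\mathcal{S}$ between rings is a Jordan semi-triple map if $\phi(xyx)=\phi(x)\phi(y)\phi(x)$ for all $x,y\in\mathcal{R}$. The comparability graph $\Gamma_{\preceq}$ has vertex set $[n]$, and two distinct vertices $i,j$ are joined by an edge precisely when $i\preceq j$ or $j\preceq i$. $E_{ij}$ are the standard matrix units, with coefficients written on the left, and $P_C:=\sum_{i\in C}E_{ii}$ for $C\subseteq[n]$. The direct sum over components $C$ denotes the sum of the matrices in the corners $P_CM_n(\mathbb{D})P_C$. For an injective endomorphism or anti-endomorphism $\theta:\mathbb{D}\to\mathbb{D}$, $\operatorname{Cent}(\theta):=\{c\in\mathbb{D}:c\theta(a)=\theta(a)c\text{ for all }a\in\mathbb{D}\}$ and $\operatorname{Cent}(\theta)^\times:=\operatorname{Cent}(\theta)\setminus\{0\}$. For a connected component $C$, $\preceq_C$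 is the restriction of $\preceq$ to $C$ (viewed as a set of ordered pairs). If $\rho$ is a preorder on a set $S$, a map $g:\rho\to\mathbb{D}^\times$ is transitive if $g(x,z)=g(x,y)g(y,z)$ for all $x,y,z\in S$ with $(x,y),(y,z)\in\rho$. For $\sigma$ an injective endomorphism of $\mathbb{D}$ and $g:\mathop{\preceq_C}\to\operatorname{Cent}(\sigma)^\times$ transitive, define on $P_C\mathcal{R}_{\preceq}P_C$ $$\Theta^M_{\sigma,g}\Bigl(\sum_{i\preceq j,\ i,j\in C}x_{ij}E_{ij}\Bigr):=\sum_{i\preceq j,\ i,j\in C}g(i,j)\sigma(x_{ij})E_{ij}.$$ For $\tau$ an injective anti-endomorphism of $\mathbb{D}$ and $h:\mathop{\preceq_C}\to\operatorname{Cent}(\tau)^\times$ transitive, define on $P_C\mathcal{R}_{\preceq}P_C$ $$\Theta^A_{\tau,h}\Bigl(\sum_{i\preceq j,\ i,j\in C}x_{ij}E_{ij}\Bigr):=\sum_{i\preceq j,\ i,j\in C}h(i,j)^{-1}\tau(x_{ij})E_{ji}.$$ *)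

(* Defs.v *)
From HB Require Import structures.
From mathcomp Require Import all_boot all_order all_algebra.

Set Implicit Arguments.
Unset Strict Implicit.
Unset Printing Implicit Defensive.

Import GRing.Theory.
Local Open Scope ring_scope.

(* A unitRingType is nontrivial, with a decidable set of units. *)
Definition division_ring (D : unitRingType) : Prop :=
  forall x : D, x != 0 -> x \is a GRing.unit.

(* Maps on a subset A of a ring are total functions, constrained only on A. *)
Definition jordan_semi_triple_on (R S : pzRingType) (A : {pred R})
    (f : R -> S) : Prop :=
  {in A &, forall x y, f (x * y * x) = f x * f y * f x}.

Definition additive_on (R S : pzRingType) (A : {pred R}) (f : R -> S) : Prop :=
  {in A &, forall x y, f (x + y) = f x + f y}.

Section Preorder.
Variables (n : nat) (le : rel 'I_n).

Definition comparability_edge : rel 'I_n :=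
  fun i j => (i != j) && (le i j || le j i).

Definition components : {set {set 'I_n}} :=
  equivalence_partition (connect comparability_edge) [set: 'I_n].

End Preorder.

Section StructuralMatrixRing.
Variables (D : unitRingType) (n : nat) (le : rel 'I_n).

Definition smr : {pred 'M[D]_n} :=
  [pred X : 'M[D]_n | [forall i, forall j, ~~ le i j ==> (X i j == 0)]].

(* The library's unitmx is restricted to commutative rings, so an element of
   GL_n(D) is given together with its two-sided inverse. *)
Definition mx_inverse (S S' : 'M[D]_n) : Prop :=
  S *m S' = 1%:M /\ S' *m S = 1%:M.

Definition P_ (C : {set 'I_n}) : 'M[D]_n := \sum_(i in C) delta_mx i i.

Definition Cent (theta : D -> D) (c : D) : Prop :=
  forall a : D, c * theta a = theta a * c.

(* A map from the set of pairs of le_C to Cent(theta)^x; the values of g at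
   the other pairs are irrelevant. *)
Definition transitive_map (C : {set 'I_n}) (theta : D -> D)
    (g : 'I_n -> 'I_n -> D) : Prop :=
  {in C &, forall i j, le i j -> g i j != 0 /\ Cent theta (g i j)} /\
  {in C & &, forall i j k, le i j -> le j k -> g i k = g i j * g j k}.

Definition ThetaM (C : {set 'I_n}) (sigma : D -> D) (g : 'I_n -> 'I_n -> D)
    (X : 'M[D]_n) : 'M[D]_n :=
  \sum_(i in C) \sum_(j in C | le i j) (g i j * sigma (X i j)) *: delta_mx i j.

Definition ThetaA (C : {set 'I_n}) (tau : D -> D) (h : 'I_n -> 'I_n -> D)
    (X : 'M[D]_n) : 'M[D]_n :=
  \sum_(i in C) \sum_(j in C | le i j)
     ((h i j)^-1 * tau (X i j)) *: delta_mx j i.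

Definition corner (C : {set 'I_n}) (X : 'M[D]_n) : 'M[D]_n :=
  P_ C *m X *m P_ C.

(* T is only constrained on the corner P_C R P_C; an anti-endomorphism of D
   is a ring morphism from D to the converse ring D^c. *)
Definition is_ThetaM (C : {set 'I_n}) (T : 'M[D]_n -> 'M[D]_n) : Prop :=
  exists (sigma : {rmorphism D -> D}) (g : 'I_n -> 'I_n -> D),
    [/\ injective sigma, transitive_map C sigma g &
        {in smr, forall X, T (corner C X) = ThetaM C sigma g (corner C X)}].

Definition is_ThetaA (C : {set 'I_n}) (T : 'M[D]_n -> 'M[D]_n) : Prop :=
  exists (tau : {rmorphism D -> D^c}) (h : 'I_n -> 'I_n -> D),
    [/\ injective tau, transitive_map C tau h &
        {in smr, forall X, T (corner C X) = ThetaA C tau h (corner C X)}].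

Definition component_map (S S' : 'M[D]_n) (eps : {set 'I_n} -> D)
    (Theta : {set 'I_n} -> 'M[D]_n -> 'M[D]_n) (X : 'M[D]_n) : 'M[D]_n :=
  S' *m (\sum_(C in components le) eps C *: Theta C (corner C X)) *m S.

End StructuralMatrixRing.

Arguments smr D {n} le.

(* Main.v *)
(* The tripotents a_i = phi (E_ii) are mutually orthogonal and nonzero, so the n
   idempotents a_i^2 are simultaneously conjugate to the E_ii. Since phi 1 squares
   to 1 and commutes with the image, psi = (phi 1) phi is, up to conjugation, a
   Jordan homomorphism fixing every E_ii, and phi 1 is a diagonal matrix of signs.
   Peirce decomposition gives psi (x E_ij) = b E_ij + c E_ji; at x = 1, b c = 0, so
   each edge i <= j is either preserved or reversed, and products of edges force
   one behaviour on each component. The scalars b or c at x = 1 intertwine the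
   Jordan endomorphisms sigma_i of D given by psi (x E_ii) = sigma_i x E_ii, so a
   diagonal conjugation makes sigma_i constant on each component. *)

Require Import Defs.
From HB Require Import structures.
From mathcomp Require Import all_boot all_order all_algebra.
From Stdlib Require Import Classical_Prop.

Set Implicit Arguments.
Unset Strict Implicit.
Unset Printing Implicit Defensive.

Import GRing.Theory.
Local Open Scope ring_scope.

(** * Additive maps preserving triple products, and Hua's dichotomy *)

(** If [x] is outside [P] and [y] outside [Q], then [y] lies in [P] and [x] in [Q], so [x + y] can
    lie in neither. This turns a pointwise alternative into a uniform one. *)
Lemma subgroup_cover (V : zmodType) (P Q : V -> Prop) :
  (forall x y, P x -> P y -> P (x - y)) ->
  (forall x y, Q x -> Q y -> Q (x - y)) ->
  (forall x, P x \/ Q x) -> (forall x, P x) \/ (forall x, Q x).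
Proof.
move=> PB QB PQ; have [allP|nP] := classic (forall x, P x); first by left.
right=> y; apply: NNPP => nQy; apply: nP => x; apply: NNPP => nPx.
have Py : P y by case: (PQ y).
have Qx : Q x by case: (PQ x).
have [Pxy|Qxy] := PQ (x + y); first by apply: nPx; rewrite -(addrK y x); apply: PB.
by apply: nQy; rewrite -(addrK x y) (addrC y); apply: QB.
Qed.

(** Expand the triple identity at [x + z]: the pure terms cancel and those mixed in [x] and [z]
    remain. *)
Lemma jst_polar (R S : pzRingType) (A : {pred R}) (f : R -> S) :
  {in A &, forall x y, x + y \in A} -> {in A &, forall x y, x * y \in A} ->
  additive_on A f -> jordan_semi_triple_on A f ->
  {in A & &, forall x y z,
     f (x * y * z + z * y * x) = f x * f y * f z + f z * f y * f x}.
Proof.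
move=> AD AM fD fT x y z Ax Ay Az.
have expand (T : pzRingType) (u v w : T) :
    (u + w) * v * (u + w) = u * v * u + w * v * w + (u * v * w + w * v * u).
  rewrite !mulrDl !mulrDr -!addrA; congr (_ + _).
  by rewrite [RHS]addrC -addrA.
have := fT (x + z) y (AD _ _ Ax Az) Ay.
have AT a b : a \in A -> b \in A -> a * y * b \in A.
  by move=> Aa Ab; apply: (AM) => //; apply: AM.
rewrite expand (fD (_ + _) (_ + _)) ?(fD (_ * _) (_ * _)) ?fT ?AT //.
- by rewrite fD // expand; apply: addrI.
- by rewrite AD ?AT.
- by rewrite AD ?AT.
Qed.

(* Hua's theorem. Polarising the triple identity gives
   (s (x y) - s x s y) (s (x y) - s y s x) = 0. *)
Lemma jordan_dichotomy (D : unitRingType) (s : D -> D) :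
  division_ring D -> {morph s : x y / x + y} -> s 1 = 1 ->
  (forall x y, s (x * y * x) = s x * s y * s x) ->
  {morph s : x y / x * y} \/ (forall x y, s (x * y) = s y * s x).
Proof.
move=> divD sD s1 sT.
have sB : {morph s : x y / x - y}.
  by move=> x y; apply: (addIr (s y)); rewrite -sD !subrK.
have polar x y z : s (x * y * z + z * y * x) = s x * s y * s z + s z * s y * s x.
  by apply: (@jst_polar _ _ predT).
have step x y : s (x * y) = s x * s y \/ s (x * y) = s y * s x.
  have prod0 : (s (x * y) - s x * s y) * (s (x * y) - s y * s x) = 0.
    have sqE : s (x * y * y * x) = s x * s y * (s y * s x).
      have yy : s (y * y) = s y * s y by rewrite -{1}[y]mulr1 sT s1 mulr1.
      by rewrite -(mulrA x) sT yy !mulrA.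
    have xyxy : s (x * y * (x * y)) = s (x * y) * s (x * y).
      by rewrite -{1}[x * y]mulr1 sT s1 mulr1.
    (* On the left this triple yields the images of [x y y x] and of [(x y)^2], the outer terms of
       the expanded product; on the right it yields the two mixed terms. *)
    have := polar (x * y) y x; rewrite sD sqE xyxy -[s (x * y) * s y * _]mulrA => E.
    by rewrite mulrBl !mulrBr opprB addrACA -opprD [s (x * y) * _ + _]addrC E subrr.
  have [/eqP|/divD nz] := eqVneq (s (x * y) - s x * s y) 0.
    by rewrite subr_eq0 => /eqP; left.
  by right; apply/eqP; rewrite -subr_eq0 -(mulKr nz (_ - _)) prod0 mulr0.
(* The covering argument is applied first in [x] and then, for each fixed [x], in [y], where [step]
   supplies the cover. *)
suff: (forall x, (forall y, s (x * y) = s x * s y)) \/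
      (forall x, (forall y, s (x * y) = s y * s x)) by case; [left | right].
apply: subgroup_cover => [x y Hx Hy z|x y Hx Hy z|x].
- by rewrite mulrBl !sB Hx Hy mulrBl.
- by rewrite mulrBl !sB Hx Hy mulrBr.
apply: subgroup_cover => [y z Hy Hz|y z Hy Hz|y //].
- by rewrite mulrBr !sB Hy Hz mulrBr.
- by rewrite mulrBr !sB Hy Hz mulrBl.
Qed.

(** * Linear algebra over a division ring *)

Lemma division_mulf_neq0 (D : unitRingType) (x y : D) :
  division_ring D -> x != 0 -> y != 0 -> x * y != 0.
Proof.
move=> divD /divD Ux y0; apply: contraNneq y0 => xy0.
by rewrite -(mulKr Ux y) xy0 mulr0.
Qed.

(** Gaussian elimination, by induction on the number of columns, with all coefficients acting from
    the left. *)
Lemma division_rows_dependent (D : unitRingType) n m (A : 'M[D]_(m, n)) :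
  division_ring D -> (n < m)%N -> exists2 x : 'rV_m, x != 0 & x *m A = 0.
Proof.
move=> divD; elim: n m A => [|n IHn] [//|m] A; first exists (const_mx 1).
- by apply/eqP => /matrixP/(_ 0 0); rewrite !mxE => /eqP; rewrite oner_eq0.
- by apply/matrixP=> ? [].
rewrite ltnS => ltnm; have [A0|] := altP (forallP (P := fun i => A i 0 == 0)).
  have [|x x0 xA] := IHn m.+1 (rsubmx (A : 'M_(_, 1 + n))); first exact: ltnW.
  exists x => //; apply/rowP=> j; rewrite mxE [RHS]mxE.
  case: (split_ordP (j : 'I_(1 + n))) => k ->.
    rewrite big1 // => i _; have -> : lshift n k = 0 :> 'I_n.+1.
      by apply: val_inj; rewrite /= ord1.
    by rewrite (eqP (A0 i)) mulr0.
  have /rowP/(_ k) := xA; rewrite !mxE => xAk; rewrite -[RHS]xAk.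
  by apply: eq_bigr => i _; rewrite mxE.
rewrite negb_forall => /existsP[p Ap].
(* Row [k] of [L *m A] is row [lift p k] of [A] minus the left multiple of the pivot row [p] that
   clears its first entry. Away from [p], the coordinates of [x *m L] are those of [x], so it stays
   nonzero. *)
pose L : 'M[D]_(m, m.+1) := \matrix_(k, j)
  ((j == lift p k)%:R - (j == p)%:R * (A (lift p k) 0 * (A p 0)^-1)).
have L0 k : (L *m A) k 0 = 0.
  rewrite mxE (bigD1_ord p) //= !mxE eqxx (negPf (neq_lift _ _)) sub0r mul1r.
  rewrite mulNr -mulrA mulVr ?divD // mulr1 (bigD1 k) //= big1 => [|j jk].
    by rewrite addr0 !mxE eqxx eq_sym (negPf (neq_lift _ _)) mul0r subr0 mul1r addNr.
  rewrite !mxE (inj_eq lift_inj) (negPf jk) eq_sym (negPf (neq_lift _ _)).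
  by rewrite mul0r subr0 mul0r.
have [x x0 xA] := IHn m (rsubmx (L *m A : 'M_(_, 1 + n))) ltnm.
exists (x *m L).
  apply: contraNneq x0 => /rowP xL; apply/eqP/rowP=> k.
  have := xL (lift p k); rewrite !mxE (bigD1 k) //= big1 => [|j jk].
    by rewrite mxE eqxx eq_sym (negPf (neq_lift _ _)) mul0r subr0 mulr1 addr0.
  rewrite !mxE (inj_eq lift_inj) eq_sym (negPf jk) eq_sym (negPf (neq_lift _ _)).
  by rewrite mul0r subr0 mulr0.
rewrite -mulmxA; apply/rowP=> j; rewrite mxE [RHS]mxE.
case: (split_ordP (j : 'I_(1 + n))) => k ->.
  rewrite big1 // => i _; have -> : lshift n k = 0 :> 'I_n.+1.
    by apply: val_inj; rewrite /= ord1.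
  by rewrite L0 mulr0.
have /rowP/(_ k) := xA; rewrite !mxE => xAk; rewrite -[RHS]xAk.
by apply: eq_bigr => i _; rewrite [X in _ = _ * X]mxE.
Qed.

(** A dependency between the rows of [V] and one unit row must involve the unit row; solving for it
    gives a left inverse [W]. Since [(V W - 1) V = 0], the rows of [V W - 1] vanish and [W] is
    two-sided. *)
Lemma division_mx_inverse (D : unitRingType) n (V : 'M[D]_n) :
  division_ring D -> (forall x : 'rV_n, x *m V = 0 -> x = 0) ->
  exists W, mx_inverse V W.
Proof.
move=> divD Vinj.
have solve (j : 'I_n) : exists w : 'rV_n, w *m V = delta_mx 0 j.
  have lt_n : (n < n + 1)%N by rewrite addn1.
  have [x x0 xA] := division_rows_dependent (col_mx V (delta_mx 0 j)) divD lt_n.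
  move: xA; rewrite -[x]hsubmxK mul_row_col; set y := lsubmx x; set z := rsubmx x.
  rewrite [z]mx11_scalar mul_scalar_mx => yz0.
  have z0 : z 0 0 != 0.
    apply: contraNneq x0 => z0; rewrite -[x]hsubmxK -/y -/z [z]mx11_scalar z0.
    have -> : y = 0 by apply: Vinj; rewrite z0 scale0r addr0 in yz0.
    by apply/eqP/rowP=> k; rewrite !mxE; case: split => ?; rewrite !mxE ?mul0rn.
  exists (- (z 0 0)^-1 *: y); rewrite -scalemxAl scaleNr -scalerN (addr0_eq yz0).
  by rewrite scalerA mulVr ?divD // scale1r.
have [w wV] := fin_all_exists solve.
pose W : 'M[D]_n := \matrix_j w j.
have WV : W *m V = 1%:M.
  by apply/row_matrixP=> j; rewrite row_mul rowK wV row1.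
exists W; split=> //; apply/eqP; rewrite -subr_eq0; apply/eqP/row_matrixP=> i.
by rewrite row0; apply: Vinj; rewrite -row_mul mulmxBl -mulmxA WV mulmx1 mul1mx subrr row0.
Qed.

(** Choose a nonzero row vector [v i] fixed by [p i] and stack these into [V]. They are independent:
    multiplying [x *m V = 0] by [p j] leaves the single term [x_j v_j]. *)
Lemma orthogonal_idempotents_diagonal (D : unitRingType) n (p : 'I_n -> 'M[D]_n) :
  division_ring D -> (forall i, p i != 0) -> (forall i, p i *m p i = p i) ->
  (forall i j, i != j -> p i *m p j = 0) ->
  exists V W, mx_inverse V W /\ forall i, V *m p i *m W = delta_mx i i.
Proof.
move=> divD p0 pp pO.
have ex_v i : exists2 v : 'rV_n, v != 0 & v *m p i = v.
  have [k pik] : exists k, row k (p i) != 0.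
    apply/existsP; apply: contraNT (p0 i); rewrite negb_exists => /forallP rows0.
    by apply/eqP/row_matrixP=> k; rewrite row0; apply/eqP; rewrite -[_ == _]negbK.
  by exists (row k (p i)); rewrite // -row_mul pp.
have [v v0 vp] := fin_all_exists2 ex_v.
pose V : 'M[D]_n := \matrix_i v i.
have Vp j : V *m p j = delta_mx j j *m V.
  apply/row_matrixP=> i; rewrite !row_mul rowK rowE mul_delta_mx_cond.
  case: eqVneq => [->|ij]; rewrite ?mulr0n ?mul0mx ?mulr1n -?rowE ?rowK ?vp //.
  by rewrite -vp -mulmxA pO ?mulmx0.
have [x xV|W [VW WV]] := division_mx_inverse (V := V) divD.
  apply/rowP=> j; rewrite mxE; apply/eqP; apply: contraNT (v0 j) => xj.
  have : x *m V *m p j = 0 by rewrite xV mul0mx.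
  rewrite -mulmxA Vp mulmxA; have -> : x *m delta_mx j j = x 0 j *: delta_mx 0 j.
    apply/rowP=> k; rewrite !mxE (bigD1 j) //= big1 => [|i ij]; last first.
      by rewrite mxE (negPf ij) mulr0.
    by rewrite mxE eqxx addr0.
  rewrite -scalemxAl -rowE rowK => xv.
  by rewrite -[v j]scale1r -(mulVr (divD _ xj)) -scalerA xv scaler0.
by exists V, W; split=> // i; rewrite Vp -mulmxA VW mulmx1.
Qed.

Lemma ex_rmorphism (R S : pzRingType) (f : R -> S) :
  {morph f : x y / x + y} -> f 1 = 1 -> {morph f : x y / x * y} ->
  exists g : {rmorphism R -> S}, g = f :> (R -> S).
Proof.
move=> fD f1 fM.
have fB : zmod_morphism f by move=> x y; apply: (addIr (f y)); rewrite -fD !subrK.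
pose fZ := GRing.isZmodMorphism.Build R S f fB.
pose fR := GRing.isMonoidMorphism.Build R S f (f1, fM).
pose F : {rmorphism R -> S} := HB.pack f fZ fR.
by exists F.
Qed.

(** * Matrix units and the structural matrix ring *)

Section StructuralMatrices.
Variables (D : unitRingType) (n : nat) (le : rel 'I_n).
Hypotheses (divD : division_ring D) (le_refl : reflexive le)
  (le_trans : transitive le).
Implicit Types (i j k l : 'I_n) (x y z : D) (X Y Z : 'M[D]_n).

Definition emx x i j : 'M[D]_n := x *: delta_mx i j.

Lemma mxDE X Y i j : (X + Y) i j = X i j + Y i j.
Proof. exact: mxE. Qed.

Lemma emxE x i j k l : emx x i j k l = x *+ ((k == i) && (l == j)).
Proof. by rewrite !mxE mulr_natr. Qed.

(* A Jordan map psi sends x E_ij to fwd psi i j x E_ij + bwd psi i j x E_ji;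
   on the diagonal both equal the Jordan endomorphism sigma_i of D. *)
Definition fwd (f : 'M[D]_n -> 'M[D]_n) i j x := f (emx x i j) i j.
Definition bwd (f : 'M[D]_n -> 'M[D]_n) i j x := f (emx x i j) j i.

Lemma emx0 i j : emx 0 i j = 0.
Proof. exact: scale0r. Qed.

Lemma emx_mulE x y i j k l : emx x i j * emx y k l = emx (x * y *+ (j == k)) i l.
Proof.
apply/matrixP=> a b; rewrite -mulmxE mxE (bigD1 j) //= big1 => [|m mj].
  rewrite !emxE eqxx addr0.
  by case: (a == i); case: (j == k); case: (b == l); rewrite ?mul0r ?mulr0 ?mul0rn.
by rewrite emxE (negPf mj) andbF mul0r.
Qed.

Lemma emx1_mull i X k l : (emx 1 i i * X) k l = X k l *+ (k == i).
Proof.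
rewrite -mulmxE mxE (bigD1 i) //= big1 => [|m mi].
  by rewrite emxE eqxx andbT addr0; case: eqVneq => [->|_]; rewrite ?mul1r ?mul0r.
by rewrite emxE (negPf mi) andbF mul0r.
Qed.

Lemma emx1_mulr i X k l : (X * emx 1 i i) k l = X k l *+ (l == i).
Proof.
rewrite -mulmxE mxE (bigD1 i) //= big1 => [|m mi].
  by rewrite emxE eqxx addr0; case: eqVneq => [->|_]; rewrite ?mulr1 ?mulr0.
by rewrite emxE (negPf mi) mulr0.
Qed.

Lemma smrP X : reflect (forall i j, ~~ le i j -> X i j = 0) (X \in smr D le).
Proof.
rewrite inE; apply: (iffP forallP) => H i; first by move=> j; move/forallP/(_ j)/implyP: (H i) => Xij /Xij/eqP.
by apply/forallP=> j; apply/implyP=> /H/eqP.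
Qed.

Lemma smr_emx x i j : le i j -> emx x i j \in smr D le.
Proof.
move=> ij; apply/smrP=> k l; rewrite emxE.
by case: eqVneq => [->|//]; case: eqVneq => [->|//]; rewrite ij.
Qed.

Lemma smr0 : 0 \in smr D le.
Proof. by apply/smrP=> i j _; rewrite mxE. Qed.

Lemma smr1 : 1 \in smr D le.
Proof.
by apply/smrP=> i j ij; rewrite mxE; case: eqVneq ij => [->|//]; rewrite le_refl.
Qed.

Lemma smrD : {in smr D le &, forall X Y, X + Y \in smr D le}.
Proof.
by move=> X Y /smrP X0 /smrP Y0; apply/smrP=> i j ij; rewrite mxE X0 ?Y0 ?addr0.
Qed.

Lemma smrM : {in smr D le &, forall X Y, X * Y \in smr D le}.
Proof.
move=> X Y /smrP X0 /smrP Y0; apply/smrP=> i j ij; rewrite -mulmxE mxE big1 // => k _.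
case: (boolP (le i k)) => [ik|/X0->]; last by rewrite mul0r.
by rewrite Y0 ?mulr0 //; apply: contra ij; apply: le_trans.
Qed.

Lemma smr_sum I (r : seq I) (P : pred I) (F : I -> 'M[D]_n) :
  (forall a, P a -> F a \in smr D le) -> \sum_(a <- r | P a) F a \in smr D le.
Proof. by move=> FP; elim/big_ind: _ => //; [exact: smr0 | exact: smrD]. Qed.

Lemma additive_on0 (f : 'M[D]_n -> 'M[D]_n) : additive_on (smr D le) f -> f 0 = 0.
Proof. by move=> fD; apply: (addrI (f 0)); rewrite -fD ?smr0 // !addr0. Qed.

Lemma additive_on_sum (f : 'M[D]_n -> 'M[D]_n) I (r : seq I) (P : pred I)
    (F : I -> 'M[D]_n) : additive_on (smr D le) f ->
  (forall a, P a -> F a \in smr D le) ->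
  f (\sum_(a <- r | P a) F a) = \sum_(a <- r | P a) f (F a).
Proof.
move=> fD FP; elim: r => [|a r IHr]; first by rewrite !big_nil additive_on0.
by rewrite !big_cons; case: ifP => // Pa; rewrite fD ?IHr ?FP ?smr_sum.
Qed.

(** * Connected components of the comparability graph *)

Lemma connect_comparability_sym : connect_sym (comparability_edge le).
Proof.
by apply: sym_connect_sym => i j; rewrite /comparability_edge eq_sym orbC.
Qed.

Lemma connect_comparability_equivalence :
  {in [set: 'I_n] & &, equivalence_rel (connect (comparability_edge le))}.
Proof.
move=> i j k _ _ _; split; first exact: connect0.
by move=> ij; rewrite (same_connect connect_comparability_sym ij).
Qed.

Definition component i := pblock (components le) i.

Lemma components_partition : partition (components le) [set: 'I_n].
Proof. exact: equivalence_partitionP connect_comparability_equivalence. Qed.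

Lemma mem_component i : i \in component i.
Proof. by rewrite mem_pblock (cover_partition components_partition). Qed.

Lemma component_in i : component i \in components le.
Proof. by rewrite pblock_mem // (cover_partition components_partition). Qed.

Lemma component_eq C i : C \in components le -> i \in C -> C = component i.
Proof. by case/and3P: components_partition => _ tI _ inC iC; rewrite /component (def_pblock tI inC). Qed.

Lemma component_ex C : C \in components le -> exists i, i \in C.
Proof.
move=> inC; apply/set0Pn; apply: contraTneq inC => ->.
by case/and3P: components_partition.
Qed.

Lemma component_connect C i j : C \in components le -> i \in C ->
  (j \in C) = connect (comparability_edge le) i j.
Proof.
move=> inC iC; rewrite (component_eq inC iC).
by rewrite pblock_equivalence_partition ?inE //; apply: connect_comparability_equivalence.
Qed.

Lemma component_le C i j : C \in components le -> le i j -> (i \in C) = (j \in C).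
Proof.
move=> inC lij; have [<-//|nij] := eqVneq i j.
have eij : connect (comparability_edge le) i j.
  by apply: connect1; rewrite /comparability_edge nij lij.
apply/idP/idP => kC; first by rewrite (component_connect _ inC kC).
by rewrite (component_connect _ inC kC) connect_comparability_sym.
Qed.

(** Serves to read an entry of a direct sum: only the block containing the row index contributes. *)
Lemma sum_components (V : nmodType) (F : {set 'I_n} -> V) i :
  (forall C, C \in components le -> i \notin C -> F C = 0) ->
  \sum_(C in components le) F C = F (component i).
Proof.
move=> F0; rewrite (bigD1 (component i)) ?component_in //= big1 ?addr0 // => C.
case/andP=> inC CN; apply: F0 => //; apply: contraNN CN => iC.
by rewrite (component_eq inC iC).
Qed.

(** * Corners of the ring *)

Lemma P_mulE (C : {set 'I_n}) X i j : (P_ D C *m X) i j = X i j *+ (i \in C).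
Proof.
rewrite mulmx_suml summxE; under eq_bigr do rewrite -[delta_mx _ _]scale1r mulmxE emx1_mull.
have [iC|iNC] := boolP (i \in C).
  rewrite (bigD1 i) //= eqxx big1 ?addr0 // => k /andP[_ ki].
  by rewrite eq_sym (negPf ki).
by rewrite big1 // => k kC; case: eqVneq iNC => [->|//]; rewrite kC.
Qed.

Lemma mul_P_E (C : {set 'I_n}) X i j : (X *m P_ D C) i j = X i j *+ (j \in C).
Proof.
rewrite mulmx_sumr summxE; under eq_bigr do rewrite -[delta_mx _ _]scale1r mulmxE emx1_mulr.
have [iC|iNC] := boolP (j \in C).
  rewrite (bigD1 j) //= eqxx big1 ?addr0 // => k /andP[_ ki].
  by rewrite eq_sym (negPf ki).
by rewrite big1 // => k kC; case: eqVneq iNC => [->|//]; rewrite kC.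
Qed.

Lemma cornerE (C : {set 'I_n}) X i j : corner C X i j = X i j *+ ((i \in C) && (j \in C)).
Proof. by rewrite mul_P_E P_mulE; do 2!case: (_ \in C). Qed.

Lemma corner_smr (C : {set 'I_n}) X : X \in smr D le -> corner C X \in smr D le.
Proof. by move/smrP=> X0; apply/smrP=> i j lij; rewrite cornerE X0 // mul0rn. Qed.

(** An entry joining two distinct components sits at a pair not related by [le], so it is zero in
    the ring. *)
Lemma sum_corner X : X \in smr D le -> \sum_(C in components le) corner C X = X.
Proof.
move/smrP=> X0; apply/matrixP=> i j; rewrite summxE (@sum_components _ _ i) => [|C inC iNC].
  rewrite cornerE mem_component; have [lij|lij] := boolP (le i j).
    by rewrite -(component_le _ lij) ?component_in ?mem_component.
  by rewrite X0 ?mul0rn.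
by rewrite cornerE (negPf iNC).
Qed.

Lemma sum_emx_entry (C : {set 'I_n}) (F : 'I_n -> 'I_n -> D) k l :
  (\sum_(i in C) \sum_(j in C | le i j) emx (F i j) i j) k l =
    F k l *+ [&& k \in C, l \in C & le k l].
Proof.
rewrite summxE.
have [kC|kNC] := boolP (k \in C); last first.
  rewrite big1 // => i iC; rewrite summxE big1 // => j _; rewrite emxE.
  by case: eqVneq kNC => [->|//]; rewrite iC.
rewrite (bigD1 k) //= [X in _ + X]big1 ?addr0 => [|i /andP[_ ik]]; last first.
  by rewrite summxE big1 // => j _; rewrite emxE eq_sym (negPf ik).
rewrite summxE; have [lC|lNC] := boolP ((l \in C) && le k l).
  rewrite (bigD1 l) //= big1 ?addr0 => [|j /andP[_ jl]]; first by rewrite emxE !eqxx.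
  by rewrite emxE eqxx eq_sym (negPf jl).
rewrite big1 // => j jC; rewrite emxE eqxx /=.
by case: eqVneq lNC => [->|//]; rewrite jC.
Qed.

Lemma corner_sum (C : {set 'I_n}) X : X \in smr D le ->
  corner C X = \sum_(i in C) \sum_(j in C | le i j) emx (X i j) i j.
Proof.
move/smrP=> X0; apply/matrixP=> i j; rewrite sum_emx_entry cornerE.
have [lij|/X0->] := boolP (le i j); first by rewrite andbT.
by rewrite !mul0rn.
Qed.

(** * Peirce decomposition of a Jordan map fixing the diagonal units *)

Section JordanMap.
Variable psi : 'M[D]_n -> 'M[D]_n.
Hypotheses (psiD : additive_on (smr D le) psi)
  (psi_inj : {in smr D le &, injective psi})
  (psiT : jordan_semi_triple_on (smr D le) psi)
  (psi_e : forall i, psi (emx 1 i i) = emx 1 i i)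
  (psi1 : psi 1 = 1).

(** Polarisation with [1] in the middle turns triple products into Jordan products. *)
Lemma psiJ : {in smr D le &, forall X Y, psi (X * Y + Y * X) = psi X * psi Y + psi Y * psi X}.
Proof.
move=> X Y RX RY; have := jst_polar smrD smrM psiD psiT RX smr1 RY.
by rewrite psi1 !mulr1.
Qed.

Lemma psi_emx_eq0 x i j : le i j -> (psi (emx x i j) == 0) = (x == 0).
Proof.
move=> ij; apply/eqP/eqP => [|->]; last by rewrite emx0 additive_on0.
rewrite -[RHS](additive_on0 psiD) => /psi_inj E.
have /matrixP/(_ i j) := E (smr_emx _ ij) smr0.
by rewrite emxE !eqxx mxE.
Qed.

Local Notation b := (fwd psi).
Local Notation c := (bwd psi).

Lemma psi_diag x i : psi (emx x i i) = emx (b i i x) i i.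
Proof.
rewrite /fwd; apply/matrixP=> k l; set Y := psi _.
have -> : Y = emx 1 i i * Y * emx 1 i i.
  rewrite -psi_e -psiT ?smr_emx ?le_refl // !emx_mulE eqxx.
  by rewrite !mulr1n mul1r mulr1.
rewrite emx1_mulr !emx1_mull emx1_mulr emx1_mull emxE !eqxx.
by case: eqVneq => [->|_]; case: eqVneq => [->|_].
Qed.

(** The Jordan product with [E_ii], and likewise with [E_jj], fixes [x E_ij], hence also its image.
    So an entry [(k, l)] of the image can be nonzero only if exactly one of [k], [l] is [i] and
    exactly one is [j]. *)
Lemma psi_off x i j : le i j -> i != j ->
  psi (emx x i j) = emx (b i j x) i j + emx (c i j x) j i.
Proof.
move=> lij nij; have nji := nij; rewrite eq_sym in nji.
rewrite /fwd /bwd; set Y := psi _.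
(* The two cases read [y + y = y] and [0 = y]; both give [y = 0] in every characteristic. *)
have half y (p q : bool) : y *+ p + y *+ q = y -> p = q -> y = 0.
  move=> + pq; rewrite pq; case: q {pq} => /= [/(canRL (addrK _))|<-].
    by rewrite subrr.
  by rewrite !mulr0n addr0.
have Yi : emx 1 i i * Y + Y * emx 1 i i = Y.
  rewrite -psi_e -psiJ ?smr_emx ?le_refl // !emx_mulE eqxx (negPf nji) mulr0n emx0 addr0.
  by rewrite mul1r.
have Yj : emx 1 j j * Y + Y * emx 1 j j = Y.
  rewrite -psi_e -psiJ ?smr_emx ?le_refl // !emx_mulE eqxx (negPf nji) mulr0n emx0 add0r.
  by rewrite mulr1.
apply/matrixP=> k l; rewrite mxE !emxE.
have := congr1 (fun M : 'M_n => M k l) Yi.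
rewrite mxE emx1_mull emx1_mulr => /half Hi.
have := congr1 (fun M : 'M_n => M k l) Yj.
rewrite mxE emx1_mull emx1_mulr => /half Hj.
have [ki|ki] := eqVneq k i; have [li|li] := eqVneq l i; rewrite /= ?andbF ?andbT.
- by rewrite ki li (negPf nij) addr0 -{1}ki -{1}li Hi ?ki ?li.
- rewrite addr0 ki; have [->//|lj] := eqVneq l j.
  by rewrite -ki Hj // ki (negPf nij) (negPf lj).
- rewrite add0r li; have [->//|kj] := eqVneq k j.
  by rewrite -li Hj // li (negPf nij) (negPf kj).
- by rewrite addr0 Hi // (negPf ki) (negPf li).
Qed.

Lemma fwd_diag1 i : b i i 1 = 1.
Proof. by rewrite /fwd psi_e emxE !eqxx. Qed.

(** In the Jordan product of [x E_ii] and [y E_ij] only [x y E_ij] survives. Its image has factors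
    in the original order at [(i, j)] and in reversed order at [(j, i)]. *)
Lemma psi_mul_left x y i j : le i j -> i != j ->
  b i j (x * y) = b i i x * b i j y /\ c i j (x * y) = c i j y * b i i x.
Proof.
move=> lij nij; have nji := nij; rewrite eq_sym in nji.
have := psiJ (smr_emx x (le_refl i)) (smr_emx y lij).
rewrite (psi_diag x) (psi_off y) // mulrDl mulrDr !emx_mulE !eqxx.
rewrite (negPf nij) (negPf nji) !mulr0n !mulr1n !emx0 !addr0 add0r => E.
by rewrite {1}/fwd {1}/bwd E ?mxDE !emxE ?mxE !eqxx (negPf nij) (negPf nji) ?addr0 ?add0r.
Qed.

Lemma psi_mul_right x y i j : le i j -> i != j ->
  b i j (y * x) = b i j y * b j j x /\ c i j (y * x) = b j j x * c i j y.
Proof.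
move=> lij nij; have nji := nij; rewrite eq_sym in nji.
have := psiJ (smr_emx x (le_refl j)) (smr_emx y lij).
rewrite (psi_diag x) (psi_off y) // mulrDl mulrDr !emx_mulE !eqxx.
rewrite (negPf nij) (negPf nji) !mulr0n !mulr1n !emx0 !addr0 !add0r => E.
by rewrite {1}/fwd {1}/bwd E ?mxDE !emxE ?mxE !eqxx (negPf nij) (negPf nji) ?addr0 ?add0r.
Qed.

(** * Preserved and reversed edges *)

(** [E_ij] squares to zero, hence so does its image, whose square has [b c] at [(i, i)]; injectivity
    excludes that both scalars vanish. *)
Lemma fwd_bwd i j : le i j -> i != j -> (c i j 1 == 0) = (b i j 1 != 0).
Proof.
move=> lij nij; have nji := nij; rewrite eq_sym in nji.
have psiN0 : psi (emx 1 i j) != 0 by rewrite psi_emx_eq0 ?oner_eq0.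
have := psiT (smr_emx 1 lij) smr1.
rewrite mulr1 psi1 mulr1 emx_mulE (negPf nji) mulr0n emx0 (additive_on0 psiD).
rewrite psi_off // mulrDl !mulrDr !emx_mulE !eqxx (negPf nij) (negPf nji).
rewrite !mulr0n !mulr1n !emx0 add0r addr0 => /matrixP/(_ i i).
rewrite ?mxDE !emxE ?mxE !eqxx (negPf nij) addr0 => /esym bc0.
move: psiN0; rewrite psi_off //.
have [->|b0 _] := eqVneq (b i j 1) 0.
  by rewrite emx0 add0r; apply: contraNF => /eqP->; rewrite emx0.
by apply: contraTT (introT eqP bc0) => c0; apply: division_mulf_neq0.
Qed.

(** Together with [fwd_right], this makes [b i j 1] intertwine [sigma_i] and [sigma_j]; [bwd_left]
    and [bwd_right] do the same for [c i j 1]. *)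
Lemma fwd_left x i j : le i j -> b i j x = b i i x * b i j 1.
Proof.
have [<- _|nij lij] := eqVneq i j; first by rewrite fwd_diag1 mulr1.
by rewrite -[x in LHS]mulr1; case: (psi_mul_left x 1 lij nij).
Qed.

Lemma fwd_right x i j : le i j -> b i j x = b i j 1 * b j j x.
Proof.
have [<- _|nij lij] := eqVneq i j; first by rewrite fwd_diag1 mul1r.
by rewrite -[x in LHS]mul1r; case: (psi_mul_right x 1 lij nij).
Qed.

Lemma bwd_diag x i : c i i x = b i i x.
Proof. by []. Qed.

Lemma bwd_left x i j : le i j -> c i j x = c i j 1 * b i i x.
Proof.
have [<- _|nij lij] := eqVneq i j; first by rewrite !bwd_diag fwd_diag1 mul1r.
by rewrite -[x in LHS]mulr1; case: (psi_mul_left x 1 lij nij).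
Qed.

Lemma bwd_right x i j : le i j -> c i j x = b j j x * c i j 1.
Proof.
have [<- _|nij lij] := eqVneq i j; first by rewrite !bwd_diag fwd_diag1 mulr1.
by rewrite -[x in LHS]mul1r; case: (psi_mul_right x 1 lij nij).
Qed.

Lemma psi_fwd x i j : le i j -> b i j 1 != 0 -> psi (emx x i j) = emx (b i j x) i j.
Proof.
have [<- _ _|nij lij] := eqVneq i j; first exact: psi_diag.
by rewrite -fwd_bwd // => /eqP c0; rewrite psi_off // bwd_left // c0 mul0r emx0 addr0.
Qed.

(** The premise is guarded by [i != j] because on the diagonal [b i i 1 = 1], while the forward and
    backward forms coincide there. *)
Lemma psi_bwd x i j : le i j -> (i != j -> b i j 1 = 0) ->
  psi (emx x i j) = emx (c i j x) j i.
Proof.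
have [<- _ _|nij lij] := eqVneq i j; first exact: psi_diag.
by move=> b0; rewrite psi_off // fwd_left // b0 // mulr0 emx0 add0r.
Qed.

Lemma bwd_neq0 i j : le i j -> (i != j -> b i j 1 = 0) -> c i j 1 != 0.
Proof.
have [<- _ _|nij lij] := eqVneq i j; first by rewrite bwd_diag fwd_diag1 oner_eq0.
by move=> b0; rewrite fwd_bwd // b0 // eqxx.
Qed.

(** [E_ij] and [E_ik] have Jordan product zero. Were the first preserved and the second reversed,
    their images would have a nonzero product [E_ki E_ij] at [(k, j)]. [fwd_target] is the mirror
    image. *)
Lemma fwd_source i j k : le i j -> i != j -> le i k -> i != k ->
  b i j 1 != 0 -> b i k 1 != 0.
Proof.
move=> lij nij lik nik bij; have [nji nki] : j != i /\ k != i by rewrite ![_ == i]eq_sym.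
  apply/negP=> /eqP bik.
have := psiJ (smr_emx 1 lij) (smr_emx 1 lik).
rewrite (psi_fwd _ lij) // (psi_bwd _ lik) // !emx_mulE eqxx.
rewrite (negPf nji) (negPf nki) !mulr0n !emx0 addr0 (additive_on0 psiD).
move/matrixP/(_ k j); rewrite ?mxDE !emxE ?mxE !eqxx (negPf nki) add0r => /esym/eqP.
by apply/negP; rewrite division_mulf_neq0 // fwd_bwd // bik eqxx.
Qed.

Lemma fwd_target i j k : le i j -> i != j -> le k j -> k != j ->
  b i j 1 != 0 -> b k j 1 != 0.
Proof.
move=> lij nij lkj nkj bij; have [nji njk] : j != i /\ j != k by rewrite ![j == _]eq_sym.
  apply/negP=> /eqP bkj.
have := psiJ (smr_emx 1 lij) (smr_emx 1 lkj).
rewrite (psi_fwd _ lij) // (psi_bwd _ lkj) // !emx_mulE eqxx.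
rewrite (negPf nji) (negPf njk) !mulr0n !emx0 addr0 (additive_on0 psiD).
move/matrixP/(_ i k); rewrite ?mxDE !emxE ?mxE !eqxx (negPf nij) addr0 => /esym/eqP.
by apply/negP; rewrite division_mulf_neq0 // fwd_bwd // bkj eqxx.
Qed.

(** Here the Jordan product of [E_ij] and [E_jk] is nonzero, since it contains [E_ik], whereas
    images of opposite directions would annihilate each other on both sides. *)
Lemma fwd_chain i j k : le i j -> i != j -> le j k -> j != k ->
  (b i j 1 != 0) = (b j k 1 != 0).
Proof.
move=> lij nij ljk njk; have nji := nij; rewrite eq_sym in nji.
have nkj := njk; rewrite eq_sym in nkj.
have := psiJ (smr_emx 1 lij) (smr_emx 1 ljk).
have psiN0 : psi (emx 1 i j * emx 1 j k + emx 1 j k * emx 1 i j) != 0.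
  apply/eqP; rewrite -(additive_on0 psiD) => /psi_inj E.
  have /matrixP/(_ i k) : emx 1 i j * emx 1 j k + emx 1 j k * emx 1 i j = 0.
    by apply: E; rewrite ?smr0 ?smrD ?smrM ?smr_emx.
  rewrite !emx_mulE eqxx ?mxDE !emxE ?mxE !eqxx (negPf nij) addr0 => /eqP.
  by rewrite !mulr1n mulr1 oner_eq0.
have [bij|bij] := eqVneq (b i j 1) 0; have [bjk|bjk] := eqVneq (b j k 1) 0 => //.
  rewrite (psi_bwd _ lij) // (psi_fwd _ ljk) // => E; case/eqP: psiN0.
  by rewrite E !emx_mulE (negPf nij) (negPf nkj) !mulr0n !emx0 addr0.
rewrite (psi_fwd _ lij) // (psi_bwd _ ljk) // => E; case/eqP: psiN0.
by rewrite E !emx_mulE (negPf njk) (negPf nji) !mulr0n !emx0 addr0.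
Qed.

(** Compare the [(i, k)] entries of the images of the Jordan product of [E_ij] and [E_jk]. When
    [k = i] there is an extra term at [(j, j)], which this entry does not see. *)
Lemma fwd_trans i j k : le i j -> le j k -> b i j 1 != 0 -> b j k 1 != 0 ->
  b i k 1 = b i j 1 * b j k 1.
Proof.
move=> lij ljk bij bjk.
have [<-|nij] := eqVneq i j; first by rewrite fwd_diag1 mul1r.
have [<-|njk] := eqVneq j k; first by rewrite fwd_diag1 mulr1.
have := psiJ (smr_emx 1 lij) (smr_emx 1 ljk).
rewrite (psi_fwd _ lij) // (psi_fwd _ ljk) // !emx_mulE eqxx mulr1 mulr1n.
rewrite psiD ?smr_emx ?le_refl ?(le_trans lij) // [psi (emx (_ *+ _) _ _)]psi_diag.
move/matrixP/(_ i k); rewrite ?mxDE !emxE ?mxE !eqxx (negPf nij) !addr0.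
exact.
Qed.

Lemma bwd_trans i j k : le i j -> le j k ->
  (i != j -> b i j 1 = 0) -> (j != k -> b j k 1 = 0) ->
  c i k 1 = c j k 1 * c i j 1.
Proof.
move=> lij ljk bij bjk.
have [<-|nij] := eqVneq i j; first by rewrite bwd_diag fwd_diag1 mulr1.
have [<-|njk] := eqVneq j k; first by rewrite bwd_diag fwd_diag1 mul1r.
have := psiJ (smr_emx 1 lij) (smr_emx 1 ljk).
rewrite (psi_bwd _ lij) // (psi_bwd _ ljk) // !emx_mulE eqxx mulr1 mulr1n.
rewrite psiD ?smr_emx ?le_refl ?(le_trans lij) // [psi (emx (_ *+ _) _ _)]psi_diag.
move/matrixP/(_ k i); rewrite ?mxDE !emxE ?mxE !eqxx (negPf nij) !andbF addr0 add0r.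
exact.
Qed.

(* Edges at a common vertex have the same direction, so this flag is constant on
   components; it is false at an isolated vertex, where Hua's dichotomy for
   sigma_i decides the type. *)
Definition vertex_fwd i : bool :=
  [exists j, (j != i) && (le i j && (b i j 1 != 0) || le j i && (b j i 1 != 0))].

(** At the source [i], another edge leaves ([fwd_source]) or enters ([fwd_chain]); at the target
    [j], it leaves ([fwd_chain]) or enters ([fwd_target]). *)
Lemma vertex_fwdP i j : le i j -> i != j ->
  vertex_fwd i = (b i j 1 != 0) /\ vertex_fwd j = (b i j 1 != 0).
Proof.
move=> lij nij; split; apply/existsP/idP => [[k /andP[nk]]|bij].
- rewrite eq_sym in nk; case/orP=> /andP[lk]; first exact: fwd_source.
  by rewrite (fwd_chain lk _ lij nij) // eq_sym.
- by exists j; rewrite eq_sym nij lij bij.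
- case/orP=> /andP[lk]; last exact: fwd_target.
  by rewrite (fwd_chain lij nij lk) // eq_sym.
- by exists i; rewrite nij lij bij orbT.
Qed.

Lemma vertex_fwd_connect i j :
  connect (comparability_edge le) i j -> vertex_fwd i = vertex_fwd j.
Proof.
apply: (closed_connect (a := vertex_fwd)) => {}i {}j /andP[nij].
rewrite /in_mem /=; case/orP=> lij; first by have [-> ->] := vertex_fwdP lij nij.
by rewrite eq_sym in nij; have [-> ->] := vertex_fwdP lij nij.
Qed.

(** Multiply the intertwiners along a path. Each edge contributes its nonzero scalar [b] or [c] at
    [1], or the inverse of that scalar when it intertwines in the opposite sense. *)
Lemma diag_conjugate i j : connect (comparability_edge le) i j ->
  exists2 d, d != 0 & forall x, b i i x * d = d * b j j x.
Proof.
case/connectP=> p; elim: p i => [|k p IHp] i /= => [_ ->|/andP[/andP[nik lik] pk] jE].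
  by exists 1; [exact: oner_neq0 | move=> x; rewrite mulr1 mul1r].
have [d d0 dE] := IHp k pk jE.
suff [d' d'0 d'E] : exists2 d', d' != 0 & forall x, b i i x * d' = d' * b k k x.
  exists (d' * d); first exact: division_mulf_neq0.
  by move=> x; rewrite mulrA d'E -mulrA dE mulrA.
have inv (y : D) (f g : D -> D) : y != 0 -> (forall x, f x * y = y * g x) ->
    forall x, g x * y^-1 = y^-1 * f x.
  by move=> /divD Uy fg x; rewrite -[g x](mulKr Uy) -fg mulrA mulrK.
case/orP: lik => lik; last rewrite eq_sym in nik.
  have [b0|b0] := eqVneq (b i k 1) 0; last first.
    by exists (b i k 1) => // x; rewrite -fwd_left // fwd_right.
  have c0 : c i k 1 != 0 by rewrite fwd_bwd // b0 eqxx.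
  exists (c i k 1)^-1; first by rewrite invr_eq0.
  by apply: (inv _ (b k k) (b i i)) => // x; rewrite -bwd_left // (bwd_right x).
have [b0|b0] := eqVneq (b k i 1) 0.
  have c0 : c k i 1 != 0 by rewrite fwd_bwd // b0 eqxx.
  by exists (c k i 1) => // x; rewrite -bwd_right // bwd_left.
exists (b k i 1)^-1; first by rewrite invr_eq0.
by apply: (inv _ (b k k) (b i i)) => // x; rewrite -fwd_left // fwd_right.
Qed.

Lemma fwd_diagD i : {morph b i i : x y / x + y}.
Proof.
by move=> x y; rewrite /fwd -mxDE -psiD ?smr_emx // /emx scalerDl.
Qed.

Lemma fwd_diagT i x y : b i i (x * y * x) = b i i x * b i i y * b i i x.
Proof.
have := psiT (smr_emx x (le_refl i)) (smr_emx y (le_refl i)).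
rewrite (psi_diag x) (psi_diag y) !emx_mulE eqxx !mulr1n => E.
by rewrite {1}/fwd E emxE !eqxx.
Qed.

Lemma fwd_diag_inj i : injective (b i i).
Proof.
move=> x y bxy; have /psi_inj E : psi (emx x i i) = psi (emx y i i).
  by rewrite psi_diag bxy -psi_diag.
have /matrixP/(_ i i) := E (smr_emx _ (le_refl i)) (smr_emx _ (le_refl i)).
by rewrite !emxE !eqxx.
Qed.

(** Evaluate a preserved edge at [x * y] in two ways and cancel its invertible value at [1]. *)
Lemma vertex_fwd_morph i : vertex_fwd i -> {morph b i i : x y / x * y}.
Proof.
case/existsP=> k /andP[nki ek] x y; case/orP: ek => /andP[lk bk].
  rewrite eq_sym in nki; apply: (mulIr (divD bk)).
  by rewrite -mulrA -!fwd_left //; case: (psi_mul_left x y lk nki).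
apply: (mulrI (divD bk)).
by rewrite mulrA -!fwd_right //; case: (psi_mul_right y x lk nki).
Qed.

Lemma bwd_antimorph i j : le i j -> i != j -> b i j 1 = 0 ->
  forall x y, b i i (x * y) = b i i y * b i i x.
Proof.
move=> lij nij bij x y; have cij := bwd_neq0 lij (fun=> bij).
apply: (mulrI (divD cij)).
by rewrite mulrA -!bwd_left //; case: (psi_mul_left x y lij nij).
Qed.

Lemma vertex_fwd_component C i j : C \in components le -> i \in C -> j \in C ->
  vertex_fwd i = vertex_fwd j.
Proof. by move=> inC iC jC; apply: vertex_fwd_connect; rewrite -(component_connect _ inC iC). Qed.

(** A preserved edge at [r] makes [sigma_r] multiplicative. A reversed edge anywhere in [C] makes
    [sigma] antimultiplicative at its source, and [diag_conjugate] carries this over to [r]. *)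
Lemma component_dichotomy C r : C \in components le -> r \in C ->
  ({in C &, forall i j, le i j -> b i j 1 != 0} /\ {morph b r r : x y / x * y}) \/
  ({in C &, forall i j, le i j -> i != j -> b i j 1 = 0} /\
   forall x y, b r r (x * y) = b r r y * b r r x).
Proof.
move=> inC rC; have [vr|nvr] := boolP (vertex_fwd r).
  left; split=> [i j iC jC lij|]; last exact: vertex_fwd_morph.
  have [<-|nij] := eqVneq i j; first by rewrite fwd_diag1 oner_eq0.
  by have [<- _] := vertex_fwdP lij nij; rewrite (vertex_fwd_component inC iC rC).
have bwdC : {in C &, forall i j, le i j -> i != j -> b i j 1 = 0}.
  move=> i j iC jC lij nij; apply/eqP; rewrite -[_ == _]negbK.
  by have [<- _] := vertex_fwdP lij nij; rewrite (vertex_fwd_component inC iC rC).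
have [/existsP[i /existsP[j /and4P[iC jC lij nij]]]|noedge] :=
    boolP [exists i, exists j, [&& i \in C, j \in C, le i j & i != j]].
  right; split=> // x y; have bij := bwdC _ _ iC jC lij nij.
  have [|d /divD Ud dE] := @diag_conjugate r i.
    by rewrite -(component_connect _ inC rC).
  apply: (mulIr Ud); rewrite dE (bwd_antimorph lij nij bij).
  by rewrite -mulrA dE mulrA -dE mulrA.
(* Without edges the conditions on directions are vacuous off the diagonal, so either outcome of the
   dichotomy fits. *)
have [brM|brA] := jordan_dichotomy divD (@fwd_diagD r) (fwd_diag1 r) (@fwd_diagT r).
  left; split=> // i j iC jC lij; have [<-|nij] := eqVneq i j.
    by rewrite fwd_diag1 oner_eq0.
  by case/existsP: noedge; exists i; apply/existsP; exists j; rewrite iC jC lij.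
by right.
Qed.

Lemma psi_corner C X : X \in smr D le ->
  psi (corner C X) = \sum_(i in C) \sum_(j in C | le i j) psi (emx (X i j) i j).
Proof.
move=> RX; rewrite corner_sum // additive_on_sum // => [|i iC].
  by apply: eq_bigr => i iC; rewrite additive_on_sum // => j /andP[_ lij]; apply: smr_emx.
by apply: smr_sum => j /andP[_ lij]; apply: smr_emx.
Qed.

(** * Normal form on components, and the signs *)

(** Conjugating by the diagonal matrix of intertwiners from each vertex to the root of its component
    replaces every [sigma_i] by that of the root. The rescaled values at [1] then supply [g] or
    [h]. *)
Lemma jordan_structure : exists T T' : 'M[D]_n, mx_inverse T T' /\
  {in components le, forall C,
     is_ThetaM le C (fun X => T' *m psi X *m T) \/
     is_ThetaA le C (fun X => T' *m psi X *m T)}.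
Proof.
pose rt := fingraph.root (comparability_edge le).
have [d d0 dE] := fin_all_exists2 (fun i =>
  diag_conjugate (connect_root (comparability_edge le) i)).
have Ud i : d i \is a GRing.unit by apply: divD.
pose T : 'M[D]_n := diag_mx (\row_i d i).
pose T' : 'M[D]_n := diag_mx (\row_i (d i)^-1).
have TT : mx_inverse T T'.
  by split; rewrite mulmx_diag -diag_const_mx; congr diag_mx; apply/rowP=> i;
    rewrite !mxE ?mulrV ?mulVr.
have conjE x i j : T' *m emx x i j *m T = emx ((d i)^-1 * x * d j) i j.
  apply/matrixP=> k l; rewrite mul_mx_diag mul_diag_mx !mxE -!/(emx _ _ _ _ _).
  by case: eqVneq => [->|_]; case: eqVneq => [->|_]; rewrite ?mulr1 ?mulr0 ?mul0r.
exists T, T'; split=> // C inC; have [i0 i0C] := component_ex inC.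
pose r := rt i0.
have rC : r \in C by rewrite (component_connect _ inC i0C) connect_root.
have rtE i : i \in C -> rt i = r.
  by move=> iC; apply/(fingraph.rootP connect_comparability_sym); rewrite -(component_connect _ inC iC).
have {}dE i x : i \in C -> b i i x * d i = d i * b r r x.
  by move=> iC; rewrite dE -/rt rtE.
have dVE i x : i \in C -> b r r x * (d i)^-1 = (d i)^-1 * b i i x.
  by move=> iC; rewrite -[b r r x](mulKr (Ud i)) -dE // mulrA mulrK.
have conj_corner X : X \in smr D le -> T' *m psi (corner C X) *m T =
    \sum_(i in C) \sum_(j in C | le i j) T' *m psi (emx (X i j) i j) *m T.
  move=> RX; rewrite psi_corner // mulmx_sumr mulmx_suml; apply: eq_bigr => i iC.
  by rewrite mulmx_sumr mulmx_suml.
have [[bC bM]|[bC bA]] := component_dichotomy inC rC; [left|right].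
  have [sigma sigmaE] := ex_rmorphism (@fwd_diagD r) (fwd_diag1 r) bM.
  exists sigma, (fun i j => (d i)^-1 * b i j 1 * d j); split.
  - by rewrite sigmaE; apply: fwd_diag_inj.
  - split=> [i j iC jC lij|i j k iC jC kC lij ljk].
      split; first by rewrite !division_mulf_neq0 ?invr_eq0 ?bC.
      (* The value [sigma_r x] becomes [sigma_j x] on passing [d j], [sigma_i x] on passing the edge
         scalar, and [sigma_r x] again on passing the inverse of [d i]. *)
      move=> x; rewrite sigmaE -mulrA -dE // mulrA -[_ * b j j x]mulrA -fwd_right //.
      by rewrite fwd_left // !mulrA dVE.
    by rewrite (fwd_trans lij ljk) ?bC // -!mulrA (mulVKr (Ud j)).
  move=> X RX; rewrite conj_corner //; apply: eq_bigr => i iC; apply: eq_bigr => j.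
  case/andP=> jC lij; rewrite cornerE iC jC sigmaE psi_fwd ?bC // conjE.
  by congr emx; rewrite fwd_right // -!mulrA dE.
have [tau tauE] := @ex_rmorphism D D^c (b r r) (@fwd_diagD r) (fwd_diag1 r) bA.
have bC' i j : i \in C -> j \in C -> le i j -> i != j -> b i j 1 = 0 by move=> *; apply: bC.
(* The inverse matches the [h^-1] in [ThetaA], and it turns the reversed order in [bwd_trans] into
   the order that transitivity asks for. *)
exists tau, (fun i j => ((d j)^-1 * c i j 1 * d i)^-1); split.
- by rewrite tauE; apply: fwd_diag_inj.
- have kU i j : i \in C -> j \in C -> le i j -> (d j)^-1 * c i j 1 * d i \is a GRing.unit.
    move=> iC jC lij; apply: divD; rewrite !division_mulf_neq0 ?invr_eq0 //.
    by apply: bwd_neq0 => //; apply: bC'.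
  split=> [i j iC jC lij|i j k iC jC kC lij ljk].
    split; first by rewrite invr_eq0; apply: contraTneq (kU _ _ iC jC lij) => ->; rewrite unitr0.
    move=> a; rewrite tauE.
    have kC : GRing.comm (b r r a) ((d j)^-1 * c i j 1 * d i).
      rewrite /GRing.comm -[RHS]mulrA -dE // [RHS]mulrA -[_ * b i i a]mulrA.
      by rewrite -bwd_left // (bwd_right a) // !mulrA dVE.
    exact: commr_sym (commrV kC).
  rewrite -invrM ?kU //; congr _^-1.
  by rewrite (bwd_trans lij ljk (bC' _ _ iC jC lij) (bC' _ _ jC kC ljk)) -!mulrA (mulVKr (Ud j)).
move=> X RX; rewrite conj_corner //; apply: eq_bigr => i iC; apply: eq_bigr => j.
case/andP=> jC lij; rewrite cornerE iC jC tauE invrK psi_bwd ?conjE; last 2 first.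
- by [].
- exact: bC'.
by congr emx; rewrite bwd_left // -!mulrA dE.
Qed.

(** Applied to the conjugate of [phi 1]. Commuting with each [E_ii] makes [B] diagonal, [B * B = 1]
    makes its entries signs, and commuting with the image of [E_ij] equates the signs at the two
    ends of an edge. *)
Lemma jordan_sign (B : 'M[D]_n) :
  B * B = 1 -> {in smr D le, forall X, B * psi X = psi X * B} ->
  exists eps : {set 'I_n} -> D,
    {in components le, forall C, eps C = 1 \/ eps C = -1} /\
    {in components le, forall C, {in smr D le, forall X,
       B * psi (corner C X) = eps C *: psi (corner C X)}}.
Proof.
move=> BB Bpsi.
have B0 i j : i != j -> B i j = 0.
  move=> nij; have := Bpsi _ (smr_emx 1 (le_refl i)); rewrite psi_e => /matrixP/(_ i j).
  by rewrite emx1_mull emx1_mulr eqxx eq_sym (negPf nij) mulr1n => <-.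
have B_mull x i j : B * emx x i j = emx (B i i * x) i j.
  apply/matrixP=> k l; rewrite -mulmxE mxE (bigD1 k) //= big1 => [|m mk].
    by rewrite !emxE addr0; case: eqVneq => [->|_]; rewrite ?mulrnAr ?mulr0.
  by rewrite B0 ?mul0r // eq_sym.
have B_mulr x i j : emx x i j * B = emx (x * B j j) i j.
  apply/matrixP=> k l; rewrite -mulmxE mxE (bigD1 l) //= big1 => [|m mk].
    by rewrite !emxE addr0 andbC; case: eqVneq => [->|_]; rewrite ?mulrnAl ?mul0r.
  by rewrite B0 ?mulr0.
have Bsign i : B i i = 1 \/ B i i = -1.
  have BB1 : (B i i + 1) * (B i i - 1) = 0.
    have /matrixP/(_ i i) := BB; rewrite -mulmxE !mxE (bigD1 i) //= big1 => [|k ki].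
      by rewrite eqxx addr0 mulrDl mul1r mulrBr mulr1 => ->; rewrite addrA subrK subrr.
    by rewrite B0 ?mul0r // eq_sym.
  have [/eqP|/divD nz] := eqVneq (B i i + 1) 0; first by rewrite addr_eq0 => /eqP; right.
  by left; apply/eqP; rewrite -subr_eq0 -(mulKr nz (_ - _)) BB1 mulr0.
have Bcomm i x : B i i * x = x * B i i.
  by case: (Bsign i) => ->; rewrite ?mulrN ?mulNr mulr1 mul1r.
have Bedge i j : le i j -> B i i = B j j.
  move=> lij; have [->//|nij] := eqVneq i j.
  have := Bpsi _ (smr_emx 1 lij).
  have [bij|bij] := eqVneq (b i j 1) 0.
    have cij := bwd_neq0 lij (fun=> bij).
    rewrite psi_bwd // B_mull B_mulr => /matrixP/(_ j i); rewrite !emxE !eqxx !mulr1n.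
    by rewrite Bcomm => /(mulrI (divD cij)).
  rewrite psi_fwd // B_mull B_mulr => /matrixP/(_ i j); rewrite !emxE !eqxx !mulr1n.
  by rewrite Bcomm => /(mulrI (divD bij)).
have Bcomponent C i j : C \in components le -> i \in C -> j \in C -> B i i = B j j.
  move=> inC iC jC; have : connect (comparability_edge le) i j.
    by rewrite -(component_connect _ inC iC).
  case/connectP=> p; elim: p i {iC} => [|k p IHp] i /= => [_ -> //|].
  case/andP=> /andP[_ /orP lik] pk jE; rewrite -(IHp k pk jE).
  by case: lik => /Bedge.
(* The value [1] is a default for the empty set, which is not a component. *)
pose eps (C : {set 'I_n}) := if [pick i in C] is Some i then B i i else 1.
have epsE C i : C \in components le -> i \in C -> eps C = B i i.
  move=> inC iC; rewrite /eps; case: pickP => [j jC|/(_ i)]; last by rewrite iC.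
  exact: (Bcomponent C).
exists eps; split=> C inC.
  by have [i iC] := component_ex inC; rewrite (epsE _ _ inC iC).
move=> X RX; rewrite psi_corner // mulr_sumr scaler_sumr; apply: eq_bigr => i iC.
rewrite mulr_sumr scaler_sumr; apply: eq_bigr => j /andP[jC lij].
have [<-|nij] := eqVneq i j.
  by rewrite psi_diag B_mull (epsE _ _ inC iC) /emx scalerA.
rewrite psi_off // mulrDr !B_mull scalerDr {1}(epsE _ _ inC iC) (epsE _ _ inC jC).
by rewrite /emx !scalerA.
Qed.

End JordanMap.

(** * The converse: direct sums of signed blocks *)

Section Converse.
Variable (C : {set 'I_n}).
Hypothesis inC : C \in components le.

Lemma ThetaM_entry (s : D -> D) g X i j :
  ThetaM le C s g X i j = (g i j * s (X i j)) *+ [&& i \in C, j \in C & le i j].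
Proof. exact: sum_emx_entry. Qed.

Lemma ThetaA_entry (s : D -> D) h X i j :
  ThetaA le C s h X j i = ((h i j)^-1 * s (X i j)) *+ [&& i \in C, j \in C & le i j].
Proof.
rewrite -(sum_emx_entry C (fun i j => (h i j)^-1 * s (X i j))) !summxE.
apply: eq_bigr => k _; rewrite !summxE; apply: eq_bigr => l _.
by rewrite !mxE andbC.
Qed.

Lemma ThetaM_corner (s : D -> D) g X : ThetaM le C s g (corner C X) = ThetaM le C s g X.
Proof.
apply/matrixP=> i j; rewrite !ThetaM_entry cornerE.
by do 2!case: (_ \in C).
Qed.

Lemma ThetaA_corner (s : D -> D) h X : ThetaA le C s h (corner C X) = ThetaA le C s h X.
Proof.
apply/matrixP=> j i; rewrite !ThetaA_entry cornerE.
by do 2!case: (_ \in C).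
Qed.

(** Transitivity splits [g i k] as [g i j * g j k], and membership in [Cent] moves [g j k] past the
    image of [X i j]. *)
Lemma ThetaM_mul (s : {rmorphism D -> D}) g : transitive_map le C s g ->
  {in smr D le &, forall X Y,
     ThetaM le C s g (X * Y) = ThetaM le C s g X * ThetaM le C s g Y}.
Proof.
move=> [g0 gM] X Y /smrP X0 /smrP Y0; apply/matrixP=> i k.
rewrite ThetaM_entry -!mulmxE !mxE rmorph_sum mulr_sumr -sumrMnl.
apply: eq_bigr => j _; rewrite !ThetaM_entry rmorphM.
have [lij|/X0->] := boolP (le i j); last by rewrite rmorph0 !(mulr0, mul0r, mul0rn).
have [ljk|/Y0->] := boolP (le j k); last by rewrite rmorph0 !(mulr0, mul0r, mul0rn).
rewrite -(component_le inC lij) (le_trans lij ljk) -(component_le inC ljk) -(component_le inC lij).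
have [iC|_] := boolP (i \in C); last by rewrite !mulr0n mul0r.
have jC : j \in C by rewrite -(component_le inC lij).
have kC : k \in C by rewrite -(component_le inC ljk).
rewrite !mulr1n (gM _ j) // -!mulrA; congr (_ * _); rewrite !mulrA; congr (_ * _).
by case: (g0 j k) => // _ ->.
Qed.

Lemma ThetaA_mul (t : {rmorphism D -> D^c}) h : transitive_map le C t h ->
  {in smr D le &, forall X Y,
     ThetaA le C t h (X * Y) = ThetaA le C t h Y * ThetaA le C t h X}.
Proof.
(* The morphism laws of [t] are restated in [D], where the product is opposite to that of the
   codomain [D^c]. *)
have t0 : t 0 = 0 :> D := rmorph0 t.
have tM x y : t (x * y) = (t y : D) * t x := rmorphM t x y.
have tS (F : 'I_n -> D) : t (\sum_j F j) = \sum_j (t (F j) : D) := rmorph_sum t _ _ _.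
move=> [h0 hM] X Y /smrP X0 /smrP Y0; apply/matrixP=> k i.
rewrite ThetaA_entry -!mulmxE !mxE tS mulr_sumr -sumrMnl.
apply: eq_bigr => j _; rewrite !ThetaA_entry tM.
have [lij|/X0->] := boolP (le i j); last by rewrite t0 !(mulr0, mul0r, mul0rn).
have [ljk|/Y0->] := boolP (le j k); last by rewrite t0 !(mulr0, mul0r, mul0rn).
rewrite -(component_le inC lij) (le_trans lij ljk) -(component_le inC ljk) -(component_le inC lij).
have [iC|_] := boolP (i \in C); last by rewrite !mulr0n mul0r.
have jC : j \in C by rewrite -(component_le inC lij).
have kC : k \in C by rewrite -(component_le inC ljk).
have [hij hC] := h0 i j iC jC lij; have [hjk _] := h0 j k jC kC ljk.
have hV : GRing.comm (t (Y j k) : D) (h i j)^-1 by apply/commrV/esym/hC.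
rewrite !mulr1n (hM _ j) // invrM ?divD // -!mulrA; congr (_ * _).
by rewrite !mulrA hV.
Qed.

End Converse.

(** Collects what both types share. Antimultiplicative maps satisfy the triple identity too, because
    reversal leaves [X * Y * X] unchanged. *)
Lemma Theta_block C T : C \in components le -> is_ThetaM le C T \/ is_ThetaA le C T ->
  [/\ {in smr D le, forall X i j, ~~ ((i \in C) && (j \in C)) -> T (corner C X) i j = 0},
      {in smr D le &, forall X Y, T (corner C (X * Y * X)) =
         T (corner C X) * T (corner C Y) * T (corner C X)} &
      {in smr D le &, forall X Y, T (corner C X) = T (corner C Y) ->
         {in C &, forall i j, X i j = Y i j}}].
Proof.
move=> inC [[s [g [s_inj gT TE]]]|[t [h [t_inj hT TE]]]]; split.
- move=> X RX i j; rewrite TE // ThetaM_entry.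
  by case: (i \in C); case: (j \in C).
- move=> X Y RX RY; rewrite !TE ?smrM // !ThetaM_corner.
  by rewrite (ThetaM_mul inC gT) ?smrM // (ThetaM_mul inC gT).
- move=> X Y RX RY; rewrite !TE // !ThetaM_corner => E i j iC jC.
  have [lij|lij] := boolP (le i j); last first.
    by rewrite (elimT (smrP _) RX) ?(elimT (smrP _) RY).
  have /matrixP/(_ i j) := E; rewrite !ThetaM_entry iC jC lij !mulr1n.
  have [gij _] := (gT.1 i j iC jC lij).
  by move/(mulrI (divD gij)); apply: s_inj.
- move=> X RX i j; rewrite TE // ThetaA_entry.
  by case: (i \in C); case: (j \in C).
- move=> X Y RX RY; rewrite !TE ?smrM // !ThetaA_corner.
  by rewrite (ThetaA_mul inC hT) ?smrM // (ThetaA_mul inC hT) // mulrA.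
- move=> X Y RX RY; rewrite !TE // !ThetaA_corner => E i j iC jC.
  have [lij|lij] := boolP (le i j); last first.
    by rewrite (elimT (smrP _) RX) ?(elimT (smrP _) RY).
  have /matrixP/(_ j i) := E; rewrite !ThetaA_entry iC jC lij !mulr1n.
  have [hij _] := (hT.1 i j iC jC lij).
  have hV : (h i j)^-1 \is a GRing.unit by rewrite unitrV divD.
  by move/(mulrI hV); apply: t_inj.
Qed.

(** Cross terms vanish because a middle index cannot lie in two distinct components. *)
Lemma sum_block_mul (M N : {set 'I_n} -> 'M[D]_n) :
  (forall C i j, C \in components le -> j \notin C -> M C i j = 0) ->
  (forall C i j, C \in components le -> i \notin C -> N C i j = 0) ->
  (\sum_(C in components le) M C) * (\sum_(C in components le) N C) =
    \sum_(C in components le) M C * N C.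
Proof.
move=> M0 N0; rewrite mulr_suml; apply: eq_bigr => C inC.
rewrite mulr_sumr (bigD1 C) //= big1 ?addr0 // => C' /andP[inC' nC].
apply/matrixP=> i j; rewrite -mulmxE !mxE big1 // => k _.
have [kC|kC] := boolP (k \in C); last by rewrite M0 ?mul0r.
rewrite N0 ?mulr0 //; apply: contraNN nC => kC'.
by rewrite (component_eq inC kC) (component_eq inC' kC').
Qed.

Lemma component_map_semi_triple (S S' : 'M[D]_n) (eps : {set 'I_n} -> D)
    (Theta : {set 'I_n} -> 'M[D]_n -> 'M[D]_n) :
  mx_inverse S S' ->
  {in components le, forall C, eps C = 1 \/ eps C = -1} ->
  {in components le, forall C,
     is_ThetaM le C (Theta C) \/ is_ThetaA le C (Theta C)} ->
  {in smr D le &, injective (component_map le S S' eps Theta)} /\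
  jordan_semi_triple_on (smr D le) (component_map le S S' eps Theta).
Proof.
move=> [SS' S'S] epsP ThetaP.
have block C (inC : C \in components le) := Theta_block inC (ThetaP C inC).
split=> X Y RX RY.
  move/(congr1 (fun Z => S *m Z *m S')).
  rewrite /component_map !mulmxA SS' !mul1mx -!mulmxA SS' !mulmx1 => E.
  have Eblock C : C \in components le -> Theta C (corner C X) = Theta C (corner C Y).
    move=> inC; have [T0 _ _] := block C inC; apply/matrixP=> i j.
    have [iC|iC] := boolP (i \in C); last by rewrite !T0 // (negPf iC).
    have {E} /matrixP/(_ i j) := E; rewrite !summxE !(@sum_components _ _ i); first last.
    - move=> C' inC' iC'; have [T'0 _ _] := block C' inC'.
      by rewrite mxE T'0 ?mulr0 // (negPf iC').
    - move=> C' inC' iC'; have [T'0 _ _] := block C' inC'.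
      by rewrite mxE T'0 ?mulr0 // (negPf iC').
    rewrite -(component_eq inC iC) !mxE.
    by case: (epsP C inC) => ->; rewrite ?mul1r // !mulN1r => /oppr_inj.
  apply/matrixP=> i j; have [lij|lij] := boolP (le i j); last first.
    by rewrite (elimT (smrP _) RX) ?(elimT (smrP _) RY).
  have [_ _ T_inj] := block _ (component_in i).
  apply: (T_inj X Y RX RY (Eblock _ (component_in i))); rewrite ?mem_component //.
  by rewrite -(component_le (component_in i) lij) mem_component.
have T0 Z C : Z \in smr D le -> C \in components le -> forall i j,
    ~~ ((i \in C) && (j \in C)) -> (eps C *: Theta C (corner C Z)) i j = 0.
  by move=> RZ inC i j ij; have [T0 _ _] := block C inC; rewrite mxE T0 ?mulr0.
rewrite /component_map !mulmxE -!mulrA (mulrA S) (mulrA S S').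
have -> : S * S' = 1 := SS'.
rewrite !mul1r !mulrA; congr (_ * _ ).
rewrite -!mulrA; congr (_ * _); rewrite mulrA sum_block_mul.
- rewrite sum_block_mul.
  + apply: eq_bigr => C inC; have [_ TM _] := block C inC.
    rewrite mulrA TM //.
    (* The sign occurs three times in the product, and its cube is itself. *)
    by case: (epsP C inC) => ->; rewrite ?scale1r // !scaleN1r !mulrNN mulrN.
  + by move=> C i j inC jC; rewrite T0 // (negPf jC) andbF.
  + move=> C i j inC iC; rewrite -mulmxE mxE big1 // => k _.
    by rewrite [X in X * _]T0 ?mul0r // (negPf iC).
- by move=> C i j inC jC; rewrite T0 // (negPf jC) andbF.
- by move=> C i j inC iC; rewrite T0 // (negPf iC).
Qed.

(** * Reduction of [phi] to a Jordan map fixing the diagonal units *)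

Lemma jordan_triple_decomposition (phi : 'M[D]_n -> 'M[D]_n) :
  {in smr D le &, injective phi} -> additive_on (smr D le) phi ->
  jordan_semi_triple_on (smr D le) phi ->
  exists (S S' : 'M[D]_n) (eps : {set 'I_n} -> D)
         (Theta : {set 'I_n} -> 'M[D]_n -> 'M[D]_n),
    [/\ mx_inverse S S',
        {in components le, forall C, eps C = 1 \/ eps C = -1},
        {in smr D le, forall X, phi X = component_map le S S' eps Theta X} &
        {in components le, forall C,
           is_ThetaM le C (Theta C) \/ is_ThetaA le C (Theta C)}].
Proof.
move=> phi_inj phiD phiT.
have polar := jst_polar smrD smrM phiD phiT.
have phi0 := additive_on0 phiD.
have Re i : emx 1 i i \in smr D le by rewrite smr_emx.
pose a i := phi (emx 1 i i).
have aT i : a i * a i * a i = a i by rewrite -phiT // !emx_mulE eqxx !mulr1.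
have aO i j : i != j -> a i * a j = 0.
  move=> nij; have nji : j != i by rewrite eq_sym.
  have aij0 : a i * a j * a i = 0.
    by rewrite -phiT // !emx_mulE (negPf nij) mulr0n mul0r mul0rn emx0.
  have e0 : emx 1 i i * emx 1 i i * emx 1 j j + emx 1 j j * emx 1 i i * emx 1 i i = 0.
    rewrite !emx_mulE (negPf nij) (negPf nji) eqxx.
    by rewrite !mulr0n !(mul0r, mul0rn) !emx0 addr0.
  (* This gives [a_i a_i a_j + a_j a_i a_i = 0]. Multiplied on the left by [a_i], the first term
     becomes [a_i a_j] and the second dies by [aij0]. *)
  have := polar _ _ _ (Re i) (Re i) (Re j); rewrite e0 phi0 => /(congr1 ( *%R (a i))).
  by rewrite mulr0 mulrDr !mulrA -!/(a _) aT aij0 mul0r addr0.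
pose p i := a i * a i.
have ap i : a i * p i = a i by rewrite mulrA aT.
have pp i : p i *m p i = p i by rewrite mulmxE {1}/p -mulrA ap.
have p0 i : p i != 0.
  apply: contra_neq (oner_neq0 D) => pi0.
  have : phi (emx 1 i i) = phi 0 by rewrite phi0 -/(a i) -ap pi0 mulr0.
  by move/phi_inj => /(_ (Re i) smr0)/matrixP/(_ i i); rewrite emxE !eqxx mxE.
have pO i j : i != j -> p i *m p j = 0.
  by move=> nij; rewrite mulmxE /p -mulrA (mulrA (a i) (a j)) aO // mul0r mulr0.
have [V [W [[VW WV] Vp]]] := orthogonal_idempotents_diagonal divD p0 pp pO.
have VW1 : V * W = 1 := VW; have WV1 : W * V = 1 := WV.
have Vp1 i : V * p i * W = emx 1 i i by rewrite /emx scale1r -Vp.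
have one_sum : 1 = \sum_i emx 1 i i :> 'M[D]_n.
  apply/matrixP=> i j; rewrite summxE (bigD1 i) //= big1 => [|k ki].
    by rewrite emxE eqxx mxE addr0 eq_sym.
  by rewrite emxE eq_sym (negPf ki).
pose A := phi 1.
have AE : A = \sum_i a i by rewrite /A one_sum additive_on_sum.
have Aa i : A * a i = p i.
  by rewrite AE mulr_suml (bigD1 i) //= big1 ?addr0 // => j ji; rewrite aO.
(* The square of [A] is the sum of the [p i], which conjugation by [V] turns into the sum of the
   [E_ii]. *)
have AA : A * A = 1.
  rewrite {2}AE mulr_sumr; under eq_bigr do rewrite Aa.
  have : V * (\sum_i p i) * W = 1.
    by rewrite mulr_sumr mulr_suml one_sum; apply: eq_bigr => i _.
  by move/(congr1 (fun Z => W * Z * V)); rewrite !mulrA WV1 mul1r mulr1 -mulrA WV1 mulr1.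
have AC : {in smr D le, forall X, A * phi X = phi X * A}.
  (* The triple [1], [X], [1] gives [phi X = A * phi X * A]; multiply by [A] on the right. *)
  move=> X RX; have := phiT _ _ smr1 RX; rewrite mul1r mulr1 -/A => E.
  by rewrite {2}E -[RHS]mulrA AA mulr1.
have R1 := smr1.
pose psi X := V * (A * phi X) * W.
have psiD : additive_on (smr D le) psi.
  by move=> X Y RX RY; rewrite /psi phiD // !mulrDr mulrDl.
have psi_inj : {in smr D le &, injective psi}.
  move=> X Y RX RY /(congr1 (fun Z => A * (W * Z * V))).
  rewrite /psi !mulrA -(mulrA A W V) WV1 mulr1 AA !mul1r -!mulrA WV1 !mulr1.
  exact: phi_inj.
have psiT : jordan_semi_triple_on (smr D le) psi.
  (* In the product of the three images, the two inner copies of [A] enclose [phi Y] and are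
     absorbed. *)
  move=> X Y RX RY; have AYA : A * phi Y * A = phi Y by rewrite -phiT // mul1r mulr1.
  rewrite /psi phiT // !mulrA -!(mulrA _ W V) WV1 !mulr1.
  by rewrite -[in LHS]AYA !mulrA.
have psi_e i : psi (emx 1 i i) = emx 1 i i by rewrite /psi -/(a i) Aa.
have psi1 : psi 1 = 1 by rewrite /psi -/A AA mulr1.
pose B := V * A * W.
have BB : B * B = 1.
  by rewrite /B !mulrA -(mulrA _ W V) WV1 mulr1 -(mulrA V A A) AA mulr1.
have BC : {in smr D le, forall X, B * psi X = psi X * B}.
  move=> X RX; rewrite /B /psi !mulrA -!(mulrA _ W V) WV1 !mulr1.
  by rewrite -[V * A * phi X * A]mulrA -AC // !mulrA.
have [T [T' [[TT' T'T] ThetaP]]] := jordan_structure psiD psi_inj psiT psi_e psi1.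
have [eps [epsP Beps]] := jordan_sign psiD psi_inj psiT psi_e psi1 BB BC.
have TT1 : T * T' = 1 := TT'.
(* Since [B * psi X = V * phi X * W], undoing first [T] and then [V] recovers [phi]; this fixes the
   order of the factors in both witnesses. *)
exists (T' *m V), (W *m T), eps, (fun=> fun X => T' *m psi X *m T); split=> //.
- by split; rewrite !mulmxE !mulrA;
    [rewrite -(mulrA T') VW1 mulr1 | rewrite -(mulrA W) TT1 mulr1].
- move=> X RX; rewrite /component_map !mulmxE.
  have -> : phi X = W * (B * psi X) * V.
    by rewrite /B /psi !mulrA WV1 mul1r -!(mulrA _ W V) WV1 !mulr1 AA mul1r.
  rewrite -[X in psi X](sum_corner RX) additive_on_sum; last 2 first.
  + exact: psiD.
  + by move=> C _; apply: corner_smr.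
  rewrite !mulr_sumr !mulr_suml; apply: eq_bigr => C inC; rewrite Beps //.
  case: (epsP C inC) => ->; rewrite ?scale1r ?scaleN1r ?(mulrN, mulNr).
    by rewrite !mulrA -!(mulrA _ T T') TT1 !mulr1.
  by rewrite !mulrA -!(mulrA _ T T') TT1 !mulr1.
Qed.


End StructuralMatrices.

Theorem theorem6p3 (D : unitRingType) (n : nat) (le : rel 'I_n)
    (divD : division_ring D)
    (cardD : exists s : seq D, uniq s /\ (2 < size s)%N)
    (le_refl : reflexive le) (le_trans : transitive le) :
  (forall phi : 'M[D]_n -> 'M[D]_n,
     {in smr D le &, injective phi} ->
     additive_on (smr D le) phi ->
     jordan_semi_triple_on (smr D le) phi ->
     exists (S S' : 'M[D]_n) (eps : {set 'I_n} -> D)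
            (Theta : {set 'I_n} -> 'M[D]_n -> 'M[D]_n),
       [/\ mx_inverse S S',
           {in components le, forall C, eps C = 1 \/ eps C = -1},
           {in smr D le, forall X, phi X = component_map le S S' eps Theta X} &
           {in components le, forall C,
              is_ThetaM le C (Theta C) \/ is_ThetaA le C (Theta C)}])
  /\
  (forall (S S' : 'M[D]_n) (eps : {set 'I_n} -> D)
          (Theta : {set 'I_n} -> 'M[D]_n -> 'M[D]_n),
     mx_inverse S S' ->
     {in components le, forall C, eps C = 1 \/ eps C = -1} ->
     {in components le, forall C,
        is_ThetaM le C (Theta C) \/ is_ThetaA le C (Theta C)} ->
     {in smr D le &, injective (component_map le S S' eps Theta)} /\
     jordan_semi_triple_on (smr D le) (component_map le S S' eps Theta)).
Proof.
split=> [phi|S S' eps Theta].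
  exact: (jordan_triple_decomposition divD le_refl le_trans).
exact: (component_map_semi_triple divD le_trans).
Qed.
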